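(* For any $\varepsilon\ge0$, the optimal value of $$(\mathrm{P}_\varepsilon)\qquad \min_{x\in\mathcal K}\left\{-\tfrac12x^{\intercal}\mathrm Mx+c^{\intercal}x-\varepsilon\mathsf H(x)\right\}$$ coincides with the optimal value of $$(\mathrm{V}_\varepsilon)\qquad \inf_{u\in\mathbb R^r}\left\{\tfrac12\|u\|^2+\min_{x\in\mathcal K}\left\{(c-\mathrm B^{\intercal}u)^{\intercal}x-\varepsilon\mathsf H(x)\right\}\right\}.$$ Moreover: (1) if $x^\star_\varepsilon$ solves $(\mathrm P_\varepsilon)$, then $u^\star_\varepsilon=\mathrm Bx^\star_\varepsilon$ solves $(\mathrm V_\varepsilon)$ and $x^\star_\varepsilon\in\operatorname{argmin}_{x\in\mathcal K}\{(c-\mathrm B^{\intercal}u^\star_\varepsilon)^{\intercal}x-\varepsilon\mathsf H(x)\}$; (2) if $u^\star_\varepsilon$ solves $(\mathrm V_\varepsilon)$, then any $\bar x\in\operatorname{argmin}_{x\in\mathcal K}\{(c-\mathrm B^{\intercal}u^\star_\varepsilon)^{\intercal}x-\varepsilon\mathsf H(x)\}$ solves $(\mathrm P_\varepsilon)$ and $u^\star_\varepsilon=\mathrm B\bar x$.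
   Context: Let $\mathrm A\in\mathbb R^{m\times n}$, $b\in\mathbb R^m$, $c\in\mathbb R^n$, $\mathcal K=\{x\in\mathbb R^n:\mathrm Ax=b,\ x\ge 0\}$, and let $\mathrm M\in\mathbb R^{n\times n}$ be symmetric positive semidefinite, written $\mathrm M=\mathrm B^{\intercal}\mathrm B$ with $\mathrm B\in\mathbb R^{r\times n}$, $r\le n$. Standing assumption: $\mathcal K$ is nonempty and bounded, and $x\mapsto-\frac12x^{\intercal}\mathrm Mx+c^{\intercal}x$ is nonconstant on $\mathcal K$. Entropy: $\mathsf H(x)=-\sum_{i=1}^nx_i\log x_i$ if $x\ge0$ (with $0\log 0=0$), and $\mathsf H(x)=-\infty$ otherwise. $\|\cdot\|$ is the Euclidean norm. *)

(* Defs.v *)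
From HB Require Import structures.
From mathcomp Require Import all_boot all_order all_algebra.
From mathcomp Require Import all_classical all_reals all_analysis.

Set Implicit Arguments.
Unset Strict Implicit.
Unset Printing Implicit Defensive.

Import Order.TTheory GRing.Theory Num.Theory.
Import numFieldNormedType.Exports.

Local Open Scope classical_set_scope.
Local Open Scope ring_scope.

Definition optval (R : realType) (T : Type) (S : set T) (f : T -> \bar R) :
    \bar R :=
  ereal_inf [set f x | x in S].

Definition argmin (R : realType) (T : Type) (S : set T) (f : T -> \bar R) :
    set T :=
  [set x | S x /\ forall y, S y -> (f x <= f y)%E].

Definition dotp (R : realType) (n : nat) (x y : 'cV[R]_n) : R :=
  (x^T *m y) 0 0.

(* The library norm on matrices is the sup norm. *)
Definition enorm (R : realType) (n : nat) (x : 'cV[R]_n) : R :=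
  Num.sqrt (\sum_i x i 0 ^+ 2).

Definition psdmx (R : realType) (n : nat) (M : 'M[R]_n) : Prop :=
  M^T = M /\ forall x : 'cV[R]_n, 0 <= dotp x (M *m x).

Definition polyhedron (R : realType) (m n : nat) (A : 'M[R]_(m, n))
    (b : 'cV[R]_m) : set 'cV[R]_n :=
  [set x | A *m x = b /\ forall i, 0 <= x i 0].

(* 0 log 0 = 0 holds because the factor x_i vanishes, whatever ln 0 is. *)
Definition entropy (R : realType) (n : nat) (x : 'cV[R]_n) : \bar R :=
  if [forall i, 0 <= x i 0] then (- \sum_i x i 0 * ln (x i 0))%:E else -oo%E.

Definition quad (R : realType) (n : nat) (M : 'M[R]_n) (c x : 'cV[R]_n) : R :=
  - (2^-1 * dotp x (M *m x)) + dotp c x.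

Definition primal_obj (R : realType) (n : nat) (M : 'M[R]_n) (c : 'cV[R]_n)
    (eps : R) (x : 'cV[R]_n) : \bar R :=
  ((quad M c x)%:E - eps%:E * entropy x)%E.

Definition inner_obj (R : realType) (n r : nat) (B : 'M[R]_(r, n))
    (c : 'cV[R]_n) (eps : R) (u : 'cV[R]_r) (x : 'cV[R]_n) : \bar R :=
  ((dotp (c - B^T *m u) x)%:E - eps%:E * entropy x)%E.

Definition outer_obj (R : realType) (n r : nat) (B : 'M[R]_(r, n))
    (c : 'cV[R]_n) (K : set 'cV[R]_n) (eps : R) (u : 'cV[R]_r) : \bar R :=
  ((2^-1 * enorm u ^+ 2)%:E + optval K (inner_obj B c eps u))%E.

(* Main.v *)
Require Import Defs.
From HB Require Import structures.
From mathcomp Require Import all_boot all_order all_algebra.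
From mathcomp Require Import all_classical all_reals all_analysis.
From mathcomp Require Import ring lra.

(** The penalized objective of the outer problem differs from the primal one by
    a square: for [x] in the polytope,
    [1/2 |u|^2 + <c - B^T u, x> - eps H(x) =
     (- 1/2 <x, M x> + <c, x> - eps H(x)) + 1/2 |u - B x|^2],
    because [<x, M x> = |B x|^2] ([inner_obj_completed_square]). Minimizing the
    left side over [x] and then over [u] gives the value of the outer problem;
    minimizing the right side over [u] makes the square vanish at [u = B x] and
    leaves the primal problem. Hence the two values agree.

    The optimizers correspond for the same reason. If [x] is primal optimal, the
    pair [(B x, x)] minimizes the right side jointly, so [B x] is optimal for the
    outer problem and [x] for the inner one. Conversely, if [u] is outer optimal
    and [x] is a minimizer of the inner problem at [u], the value at [(u, x)] is
    the common optimal value, so both nonnegative excesses, that of the primal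
    objective at [x] over its minimum and the square, are zero.

    This argument uses that the minima are attained. The polytope is compact by
    Heine-Borel, and on it both objectives are real-valued and continuous; the
    only delicate point is the continuity of [x ln x] at [0]
    ([continuous_xlnx]). *)

Set Implicit Arguments.
Unset Strict Implicit.
Unset Printing Implicit Defensive.

Import Order.TTheory GRing.Theory Num.Theory.
Import numFieldNormedType.Exports.

Local Open Scope classical_set_scope.
Local Open Scope ring_scope.

(** * The inner product *)

Lemma dotpE (R : realType) (n : nat) (x y : 'cV[R]_n) :
  dotp x y = \sum_i x i 0 * y i 0.
Proof. by rewrite /dotp mxE; apply: eq_bigr => i _; rewrite mxE. Qed.

Lemma dotpC (R : realType) (n : nat) (x y : 'cV[R]_n) : dotp x y = dotp y x.
Proof. by rewrite !dotpE; apply: eq_bigr => i _; rewrite mulrC. Qed.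

Lemma dotpBl (R : realType) (n : nat) (x y z : 'cV[R]_n) :
  dotp (x - y) z = dotp x z - dotp y z.
Proof. by rewrite /dotp linearB mulmxBl !mxE. Qed.

Lemma dotpBr (R : realType) (n : nat) (x y z : 'cV[R]_n) :
  dotp x (y - z) = dotp x y - dotp x z.
Proof. by rewrite dotpC dotpBl !(dotpC x). Qed.

Lemma dotp_trmxl (R : realType) (n r : nat) (B : 'M[R]_(r, n))
    (u : 'cV[R]_r) (x : 'cV[R]_n) :
  dotp (B^T *m u) x = dotp u (B *m x).
Proof. by rewrite /dotp trmx_mul trmxK mulmxA. Qed.

Lemma enorm_sqr (R : realType) (n : nat) (x : 'cV[R]_n) :
  enorm x ^+ 2 = dotp x x.
Proof.
rewrite /enorm sqr_sqrtr ?sumr_ge0 // => [|i _]; last exact: sqr_ge0.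
by rewrite dotpE; apply: eq_bigr => i _; rewrite expr2.
Qed.

Lemma enorm0 (R : realType) (n : nat) : enorm (0 : 'cV[R]_n) = 0.
Proof.
by rewrite /enorm big1 ?sqrtr0 // => i _; rewrite mxE expr0n.
Qed.

Lemma enorm_eq0 (R : realType) (n : nat) (x : 'cV[R]_n) :
  enorm x = 0 -> x = 0.
Proof.
move=> x0; apply/colP => i; rewrite mxE.
have: \sum_i x i 0 ^+ 2 == 0.
  have := enorm_sqr x; rewrite x0 expr0n dotpE => /esym/eqP.
  by congr (_ == _); apply: eq_bigr => j _; rewrite expr2.
rewrite psumr_eq0 => [|j _]; last exact: sqr_ge0.
by move/allP/(_ i); rewrite mem_index_enum sqrf_eq0 => /(_ isT)/eqP.
Qed.

(** Completing the square in [u]. The concave quadratic becomes an infimum over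
    [u] of functions affine in [x]; the square is the gap left when [u] differs
    from the minimizer [B *m x]. *)
Lemma quad_completed_square (R : realType) (n r : nat) (B : 'M[R]_(r, n))
    (c x : 'cV[R]_n) (u : 'cV[R]_r) :
  2^-1 * enorm u ^+ 2 + dotp (c - B^T *m u) x =
  quad (B^T *m B) c x + 2^-1 * enorm (u - B *m x) ^+ 2.
Proof.
rewrite /quad !enorm_sqr !dotpBr !dotpBl !dotp_trmxl -mulmxA.
rewrite (dotpC x) dotp_trmxl (dotpC (B *m x) u); lra.
Qed.

(** * Continuity of the objectives *)

(** For [0 < x], the bound [ln y < y] at [y = (Num.sqrt x)^-1] gives
    [- ln x < 2 / Num.sqrt x]; multiply by [x]. *)
Lemma normr_xlnx_le (R : realType) (x : R) :
  x <= 1 -> `|x * ln x| <= 2 * Num.sqrt x.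
Proof.
move=> x1; have [x0|x0] := leP x 0.
  by rewrite ln0 // mulr0 normr0 mulr_ge0 // sqrtr_ge0.
pose s := Num.sqrt x.
have s0 : 0 < s by rewrite sqrtr_gt0.
have xE : x = s ^+ 2 by rewrite sqr_sqrtr // ltW.
rewrite normrM (gtr0_norm x0) ler0_norm ?ln_le0 // -/s xE lnXn //.
have := @ln_sublinear R s^-1; rewrite invr_gt0 lnV ?posrE // => /(_ s0) lns.
have -> : s ^+ 2 * - (ln s *+ 2) = 2 * s * (s * - ln s) by rewrite mulr2n; ring.
rewrite ler_piMr //; first by rewrite mulr_ge0 // ltW.
by rewrite -(mulfV (lt0r_neq0 s0)) ler_pM2l // ltW.
Qed.

(** Continuity holds on the whole line because [ln] is [0] on nonpositive reals;
    at [0], squeeze with [normr_xlnx_le]. *)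
Lemma continuous_xlnx (R : realType) : continuous (fun x : R => x * ln x).
Proof.
move=> x; have [x0|x0|->] := ltgtP x 0.
- rewrite /continuous_at ln0 ?mulr0 ?ltW //; apply: cvg_near_cst.
  near=> y; rewrite ln0 ?mulr0 //; apply: ltW; near: y.
  exact: lt_nbhsl.
- by apply: cvgM; [exact: cvg_id|exact: continuous_ln].
- rewrite /continuous_at mul0r; apply/norm_cvg0P.
  have sq0 : (2 : R) * Num.sqrt y @[y --> (0 : R)] --> (0 : R).
    rewrite -[X in _ --> X](mulr0 (2 : R)) -[in X in _ --> X](sqrtr0 R).
    by apply: cvgM; [exact: cvg_cst|exact: sqrt_continuous].
  apply: (squeeze_cvgr _ (cvg_cst (0 : R)) sq0).
  near=> y; rewrite normr_ge0 normr_xlnx_le //; apply: ltW; near: y.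
  by apply: lt_nbhsl; exact: ltr01.
Unshelve. all: by end_near. Qed.

Definition negentropy (R : realType) (n : nat) (x : 'cV[R]_n) : R :=
  \sum_i x i 0 * ln (x i 0).

Lemma continuous_sum (R : realType) (T : topologicalType) (I : finType)
    (f : I -> T -> R) :
  (forall i, continuous (f i)) -> continuous (fun x => \sum_i f i x).
Proof.
move=> cf; apply: (@continuous_big R I +%R 0 xpredT) => [|i _]; last exact: cf.
by move=> x; exact: add_continuous.
Qed.

Lemma continuousMl (R : realType) (T : topologicalType) (a : R) (f : T -> R) :
  continuous f -> continuous (fun x => a * f x).
Proof.
move=> cf x; apply: (@cvgM _ _ _ _ (fun=> a)); [exact: cvg_cst|exact: cf].
Qed.

Lemma continuous_addr (R : realType) (T : topologicalType) (f g : T -> R) :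
  continuous f -> continuous g -> continuous (fun x => f x + g x).
Proof. by move=> cf cg x; apply: cvgD; [exact: cf|exact: cg]. Qed.

Lemma continuous_negentropy (R : realType) (n : nat) :
  continuous (@negentropy R n).
Proof.
apply: (continuous_sum
  (f := fun i (x : 'cV[R]_n) => x i 0 * ln (x i 0))) => i x.
apply: (@continuous_comp _ _ _ (fun x : 'cV[R]_n => x i 0)
  (fun t : R => t * ln t)); first exact: coord_continuous.
exact: continuous_xlnx.
Qed.

Lemma continuous_dotp (R : realType) (T : topologicalType) (n : nat)
    (f g : T -> 'cV[R]_n) :
  (forall i, continuous (fun x => f x i 0)) ->
  (forall i, continuous (fun x => g x i 0)) ->
  continuous (fun x => dotp (f x) (g x)).
Proof.
move=> cf cg.
rewrite (_ : (fun _ => _) = fun x => \sum_i f x i 0 * g x i 0); last first.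
  by apply/funext => x; rewrite dotpE.
by apply: (continuous_sum (f := fun i x => f x i 0 * g x i 0)) => i x;
  apply: cvgM; [exact: cf|exact: cg].
Qed.

Lemma continuous_mulmx_coord (R : realType) (m n : nat) (A : 'M[R]_(m, n)) i :
  continuous (fun x : 'cV[R]_n => (A *m x) i 0).
Proof.
rewrite (_ : (fun _ => _) =
    fun x : 'cV[R]_n => \sum_j A i j * x j 0); last first.
  by apply/funext => x; rewrite mxE.
apply: (continuous_sum (f := fun j (x : 'cV[R]_n) => A i j * x j 0)) => j.
by apply: continuousMl; exact: coord_continuous.
Qed.

Lemma continuous_quad (R : realType) (n : nat) (M : 'M[R]_n) (c : 'cV[R]_n) :
  continuous (quad M c).
Proof.
rewrite (_ : quad M c =
    fun x => - 2^-1 * dotp x (M *m x) + dotp c x); last first.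
  by apply/funext => x; rewrite /quad mulNr.
apply: continuous_addr; first apply: continuousMl.
  by apply: (continuous_dotp (f := id) (g := mulmx M)) => i;
    [exact: coord_continuous|exact: continuous_mulmx_coord].
by apply: (continuous_dotp (f := fun=> c) (g := id)) => i;
  [move=> x; exact: cst_continuous|exact: coord_continuous].
Qed.

(** * Compactness of the polytope *)

Lemma continuous_trmx (T : topologicalType) (m n : nat) :
  continuous (@trmx T m n).
Proof.
move=> M U [P MP PU]; exists (fun i j => P j i) => [i j|N PN].
  by have := MP j i; rewrite mxE.
by apply: PU => i j; rewrite mxE; exact: PN.
Qed.

Lemma coord_le_norm (R : realType) (m n : nat) (x : 'M[R]_(m, n)) i j :
  `|x i j| <= `|x|.
Proof.
rewrite [leRHS]/Num.norm /= mx_normrE.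
by apply/bigmax_geP; right; exists (i, j).
Qed.

(** Heine-Borel for column vectors: transposition carries a box of row vectors,
    which is compact by Tychonoff, onto a box containing the set. *)
Lemma cV_bounded_closed_compact (R : realType) (n : nat) (S : set 'cV[R]_n) :
  bounded_set S -> closed S -> compact S.
Proof.
move=> [C [_ SC]] Scl.
pose box := [set v : 'rV[R]_n | forall i, v 0 i \in `[- (C + 1), C + 1]].
have box_compact : compact box.
  apply: (@rV_compact _ _ (fun=> `[(- (C + 1)), (C + 1)]%classic)) => _.
  exact: segment_compact.
have cboxT : compact (trmx @` box).
  apply: continuous_compact box_compact; apply: continuous_subspaceT.
  exact: continuous_trmx.
apply: subclosed_compact Scl cboxT _ => x Sx.
exists x^T; last by rewrite trmxK.
move=> i; rewrite mxE in_itv /= -ler_norml.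
by apply: le_trans (coord_le_norm x i 0) (SC _ _ _ Sx); rewrite ltrDl.
Qed.

Lemma polyhedron_closed (R : realType) (m n : nat) (A : 'M[R]_(m, n))
    (b : 'cV[R]_m) : closed (polyhedron A b).
Proof.
have -> : polyhedron A b =
    (\bigcap_(i in [set: 'I_m])
      (fun x : 'cV[R]_n => (A *m x) i 0) @^-1` [set t | t = b i 0]) `&`
    (\bigcap_(i in [set: 'I_n])
      (fun x : 'cV[R]_n => x i 0) @^-1` [set t | 0 <= t]).
  apply/seteqP; split => [x [Axb x0]|x [Axb x0]].
    by split => i _ /=; [rewrite Axb|exact: x0].
  by split; [apply/colP => i; exact: Axb|move=> i; exact: x0].
apply: closedI; apply: closed_bigI => i _; apply: preimage_closed.
- by move=> x _; exact: continuous_mulmx_coord.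
- exact: closed_eq.
- by move=> x _; exact: coord_continuous.
- exact: closed_ge.
Qed.

(** * Minimizers *)

Lemma argmin_optval (R : realType) (T : Type) (S : set T) (f : T -> \bar R) x :
  argmin S f x -> optval S f = f x.
Proof.
move=> [Sx xmin]; apply/eqP; rewrite eq_le; apply/andP; split.
  by apply: ereal_inf_lbound; exists x.
by apply/ereal_infP => _ [y Sy <-]; exact: xmin.
Qed.

Lemma argmin_compact (R : realType) (T : topologicalType) (S : set T)
    (f : T -> \bar R) (g : T -> R) :
  (forall x, S x -> f x = (g x)%:E) -> continuous g ->
  compact S -> S !=set0 -> argmin S f !=set0.
Proof.
move=> fE cg cS S0.
have [|x /set_mem Sx xmin] := compact_EVT_min S0 cS (f := g).
  exact: continuous_subspaceT.
exists x; split => // y Sy; rewrite !fE // lee_fin.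
by apply: xmin; exact/mem_set.
Qed.

(** * The objectives on the polytope *)

Lemma entropyE (R : realType) (m n : nat) (A : 'M[R]_(m, n)) (b : 'cV[R]_m)
    (x : 'cV[R]_n) :
  polyhedron A b x -> entropy x = (- negentropy x)%:E.
Proof. by move=> [_ x0]; rewrite /entropy ifT //; apply/forallP. Qed.

Lemma primal_objE (R : realType) (m n : nat) (A : 'M[R]_(m, n))
    (b : 'cV[R]_m) (M : 'M[R]_n) (c : 'cV[R]_n) (eps : R) (x : 'cV[R]_n) :
  polyhedron A b x ->
  primal_obj M c eps x = (quad M c x + eps * negentropy x)%:E.
Proof.
move=> Kx; rewrite /primal_obj (entropyE Kx) -EFinM -EFinB.
by rewrite mulrN opprK.
Qed.

Lemma inner_objE (R : realType) (m n r : nat) (A : 'M[R]_(m, n))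
    (b : 'cV[R]_m) (B : 'M[R]_(r, n)) (c : 'cV[R]_n) (eps : R) (u : 'cV[R]_r)
    (x : 'cV[R]_n) :
  polyhedron A b x ->
  inner_obj B c eps u x = (dotp (c - B^T *m u) x + eps * negentropy x)%:E.
Proof.
move=> Kx; rewrite /inner_obj (entropyE Kx) -EFinM -EFinB.
by rewrite mulrN opprK.
Qed.

(** The entropy is common to both sides, so the completed square survives the
    regularization. *)
Lemma inner_obj_completed_square (R : realType) (m n r : nat)
    (A : 'M[R]_(m, n)) (b : 'cV[R]_m) (B : 'M[R]_(r, n)) (c : 'cV[R]_n)
    (eps : R) (u : 'cV[R]_r) (x : 'cV[R]_n) :
  polyhedron A b x ->
  ((2^-1 * enorm u ^+ 2)%:E + inner_obj B c eps u x =
   primal_obj (B^T *m B) c eps x + (2^-1 * enorm (u - B *m x) ^+ 2)%:E)%E.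
Proof.
move=> Kx; rewrite (inner_objE _ _ _ _ Kx) (primal_objE _ _ _ Kx) -!EFinD.
by congr _%:E; rewrite addrA quad_completed_square addrAC.
Qed.

(** * Equivalence of the two problems *)

(** Evaluating the inner minimum at one feasible [x]; at [u = B *m x] the square
    vanishes, so the outer problem does at least as well as the primal one. *)
Lemma outer_obj_le (R : realType) (m n r : nat)
    (A : 'M[R]_(m, n)) (b : 'cV[R]_m) (B : 'M[R]_(r, n)) (c : 'cV[R]_n)
    (eps : R) (u : 'cV[R]_r) (x : 'cV[R]_n) :
  polyhedron A b x ->
  (outer_obj B c (polyhedron A b) eps u <=
   primal_obj (B^T *m B) c eps x + (2^-1 * enorm (u - B *m x) ^+ 2)%:E)%E.
Proof.
move=> Kx; rewrite -(inner_obj_completed_square _ _ _ _ Kx) /outer_obj.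
by apply: leeD2l; apply: ereal_inf_lbound; exists x.
Qed.

Lemma outer_obj_argmin (R : realType) (m n r : nat)
    (A : 'M[R]_(m, n)) (b : 'cV[R]_m) (B : 'M[R]_(r, n)) (c : 'cV[R]_n)
    (eps : R) (u : 'cV[R]_r) (x : 'cV[R]_n) :
  argmin (polyhedron A b) (inner_obj B c eps u) x ->
  outer_obj B c (polyhedron A b) eps u =
  (primal_obj (B^T *m B) c eps x + (2^-1 * enorm (u - B *m x) ^+ 2)%:E)%E.
Proof.
move=> xmin; rewrite /outer_obj (argmin_optval xmin).
by rewrite (inner_obj_completed_square _ _ _ _ xmin.1).
Qed.

Theorem proposition1 (R : realType) (m n r : nat)
    (A : 'M[R]_(m, n)) (b : 'cV[R]_m) (c : 'cV[R]_n)
    (M : 'M[R]_n) (B : 'M[R]_(r, n)) (eps : R)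
    (r_le_n : (r <= n)%N)
    (M_psd : psdmx M)
    (M_eq : M = B^T *m B)
    (K_neq0 : polyhedron A b !=set0)
    (K_bounded : bounded_set (polyhedron A b))
    (quad_nonconst : exists x y, [/\ polyhedron A b x, polyhedron A b y &
                                     quad M c x != quad M c y])
    (eps_ge0 : 0 <= eps) :
  let K := polyhedron A b in
  let P := primal_obj M c eps in
  let V := outer_obj B c K eps in
  [/\ (* the minimum in the primal problem and the inner minima are attained *)
      argmin K P !=set0 /\ (forall u, argmin K (inner_obj B c eps u) !=set0),
      optval K P = optval setT V,
      (forall x, argmin K P x ->
         argmin setT V (B *m x) /\
         argmin K (inner_obj B c eps (B *m x)) x) &
      (forall u, argmin setT V u ->
         forall x, argmin K (inner_obj B c eps u) x ->
           argmin K P x /\ u = B *m x)].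
Proof.
move=> K P V.
have cptK : compact K.
  exact: cV_bounded_closed_compact K_bounded (@polyhedron_closed _ _ _ A b).
have Pmin : argmin K P !=set0.
  apply: (argmin_compact (g := fun x => quad M c x + eps * negentropy x)) => //.
    by move=> x Kx; exact: (primal_objE M c eps Kx).
  apply: continuous_addr; first exact: continuous_quad.
  by apply: continuousMl; exact: continuous_negentropy.
have Imin u : argmin K (inner_obj B c eps u) !=set0.
  apply: (argmin_compact
    (g := fun x => dotp (c - B^T *m u) x + eps * negentropy x)) => //.
    by move=> x Kx; exact: (inner_objE B c eps u Kx).
  apply: continuous_addr.
    by apply: (continuous_dotp (f := fun=> c - B^T *m u) (g := id)) => i;
      [move=> x; exact: cst_continuous|exact: coord_continuous].
  by apply: continuousMl; exact: continuous_negentropy.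
have PE x : P x = primal_obj (B^T *m B) c eps x by rewrite /P M_eq.
have Pmin_le_V x u : argmin K P x -> (P x <= V u)%E.
  move=> [_ xmin]; have [y ymin] := Imin u.
  rewrite /V (outer_obj_argmin ymin) -PE.
  apply: le_trans (xmin y ymin.1) _.
  by rewrite leeDl // lee_fin mulr_ge0 ?invr_ge0 ?sqr_ge0.
have V_le_P x : K x -> (V (B *m x) <= P x)%E.
  move=> Kx; have := outer_obj_le B c eps (B *m x) Kx.
  by rewrite subrr enorm0 expr0n mulr0 adde0 -PE.
have V_argmin x : argmin K P x -> V (B *m x) = P x.
  by move=> xmin; apply/eqP; rewrite eq_le V_le_P ?Pmin_le_V //; case: xmin.
have VB_argmin x : argmin K P x -> argmin setT V (B *m x).
  by move=> xmin; split => // u _; rewrite V_argmin // Pmin_le_V.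
split.
- by split.
- have [x xmin] := Pmin.
  by rewrite (argmin_optval xmin) (argmin_optval (VB_argmin x xmin)) V_argmin.
- move=> x xmin; split; first exact: VB_argmin.
  split=> [|y Ky]; first by case: xmin.
  (* Adding 1/2 |B x|^2 turns the inner value at x into the primal minimum,
     which bounds the outer objective at B x from below. *)
  rewrite -(@leeD2lE _ (2^-1 * enorm (B *m x) ^+ 2)%:E) //.
  have -> : ((2^-1 * enorm (B *m x) ^+ 2)%:E + inner_obj B c eps (B *m x) x =
      P x)%E.
    by rewrite (inner_obj_completed_square _ _ _ _ xmin.1) subrr enorm0
       expr0n mulr0 adde0 -PE.
  apply: le_trans (Pmin_le_V x (B *m x) xmin) _.
  by apply: leeD2l; apply: ereal_inf_lbound; exists y.
- move=> u [_ umin] x xmin.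
  have [y ymin] := Pmin.
  (* The excess of P at x over its minimum and the square sum to at most 0. *)
  have gap_le : (P x + (2^-1 * enorm (u - B *m x) ^+ 2)%:E <= P y)%E.
    rewrite PE -(outer_obj_argmin xmin).
    by apply: le_trans (umin (B *m y) I) (V_le_P _ ymin.1).
  have Px_le : (P x <= P y)%E.
    apply: le_trans gap_le.
    by rewrite leeDl // lee_fin mulr_ge0 ?invr_ge0 ?sqr_ge0.
  split.
    split=> [|z Kz]; first by case: xmin.
    exact: le_trans Px_le (ymin.2 z Kz).
  apply/eqP; rewrite -subr_eq0; apply/eqP; apply: enorm_eq0.
  have PyE : P y = P x.
    by apply/eqP; rewrite eq_le Px_le (ymin.2 x xmin.1).
  move: gap_le; rewrite PyE.
  rewrite /P (primal_objE M c eps xmin.1) -EFinD lee_fin.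
  rewrite gerDl pmulr_rle0 ?invr_gt0 // => gap0.
  by apply/eqP; rewrite -sqrf_eq0 eq_le gap0 sqr_ge0.
Qed.
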